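(* Let $u,v$ be rational functions with $u(n)>0$ for all integers $n\ge 2$, and let $\{a_n\}_{n\geq 0}$ be a sequence of positive real numbers satisfying $a_n=u(n)a_{n-1}+v(n)a_{n-2}$ for $n\ge 2$. Assume that for all $n\geq 2$, $v(n)>0$ and $u(n)^3>u(n+1)v(n)$. If there exist a nonnegative integer $N$ and a function $g$ such that for all $n\geq N+2$: (i) $a_n/a_{n-1}\geq g(n) \geq u(n)$; and (ii) $g(n)^4-u(n) g(n)^3-u(n+1)v(n) g(n)-v(n)v(n+1)> 0$, then the sequence $\{a_n\}_{n\geq N}$ is ratio log-concave.
   Context: A sequence $(x_n)_{n\ge m}$ of positive reals is log-concave if $x_n^2\ge x_{n-1}x_{n+1}$ for all $n\ge m+1$. A sequence $(a_n)_{n\ge m}$ of positive reals is ratio log-concave if $(a_{n+1}/a_n)_{n\ge m}$ is log-concave. *)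

(* Defs.v *)
From HB Require Import structures.
From mathcomp Require Import all_boot all_order all_algebra.
From mathcomp Require Import generic_quotient.
From mathcomp Require Import reals.

Set Implicit Arguments.
Unset Strict Implicit.
Unset Printing Implicit Defensive.

Import Order.TTheory GRing.Theory Num.Theory.
Local Open Scope ring_scope.
Local Open Scope quotient_scope.

(* Rational functions are the elements of the field {fraction {poly F}}.
   The representative chosen by [repr] need not be in lowest terms, so it is
   reduced first: removable singularities are thereby removed, and the value
   is the usual one wherever the function is defined ([ratf_evalE]).  At a
   pole the value is 0 ([ratf_eval_pole]), since 0^-1 = 0. *)
Definition ratf_num (F : fieldType) (f : {fraction {poly F}}) : {poly F} :=
  \n_(repr f) %/ gcdp \n_(repr f) \d_(repr f).

Definition ratf_den (F : fieldType) (f : {fraction {poly F}}) : {poly F} :=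
  \d_(repr f) %/ gcdp \n_(repr f) \d_(repr f).

Definition ratf_eval (F : fieldType) (f : {fraction {poly F}}) (x : F) : F :=
  (ratf_num f).[x] / (ratf_den f).[x].

Definition log_concave_from (R : realType) (m : nat) (x : nat -> R) : Prop :=
  (forall n, (m <= n)%N -> 0 < x n) /\
  (forall n, (m.+1 <= n)%N -> x n ^+ 2 >= x n.-1 * x n.+1).

Definition ratio_log_concave_from (R : realType) (m : nat) (a : nat -> R) :
    Prop :=
  (forall n, (m <= n)%N -> 0 < a n) /\
  log_concave_from m (fun n => a n.+1 / a n).

Lemma ratf_coprime (F : fieldType) (f : {fraction {poly F}}) :
  coprimep (ratf_num f) (ratf_den f).
Proof.
apply: coprimep_div_gcd; apply/orP; right; exact: denom_ratioP.
Qed.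

Lemma ratf_den_neq0 (F : fieldType) (f : {fraction {poly F}}) :
  ratf_den f != 0.
Proof.
by rewrite dvdp_div_eq0 ?dvdp_gcdr // denom_ratioP.
Qed.

Lemma ratf_numden (F : fieldType) (f : {fraction {poly F}}) :
  f = FracField.tofrac (ratf_num f) / FracField.tofrac (ratf_den f).
Proof.
have nzd : \d_(repr f) != 0 := denom_ratioP _.
have nzg : gcdp \n_(repr f) \d_(repr f) != 0.
  by rewrite gcdp_eq0 negb_and nzd orbT.
have En : \n_(repr f) = ratf_num f * gcdp \n_(repr f) \d_(repr f).
  by rewrite divpK ?dvdp_gcdl.
have Ed : \d_(repr f) = ratf_den f * gcdp \n_(repr f) \d_(repr f).
  by rewrite divpK ?dvdp_gcdr.
have Ef : f * FracField.tofrac \d_(repr f) = FracField.tofrac \n_(repr f).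
  rewrite -{1}[f]reprK !piE; apply/eqmodP => /=.
  rewrite /FracField.mulf /= FracField.equivfE.
  by rewrite !numden_Ratio ?mulr1 ?oner_neq0 // mulrC.
have nzt : FracField.tofrac (ratf_den f) != 0.
  by rewrite tofrac_eq0 ratf_den_neq0.
apply: (mulIf nzt); rewrite divfK //.
have nzG : FracField.tofrac (gcdp \n_(repr f) \d_(repr f)) != 0.
  by rewrite tofrac_eq0.
by apply: (mulIf nzG); rewrite -mulrA -!tofracM -En -Ed.
Qed.

Lemma ratf_eval_pole (F : fieldType) (f : {fraction {poly F}}) (x : F) :
  root (ratf_den f) x -> ratf_eval f x = 0.
Proof. by move=> /rootP dx; rewrite /ratf_eval dx invr0 mulr0. Qed.

Lemma ratf_evalE (F : fieldType) (p q : {poly F}) (x : F) :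
  q.[x] != 0 ->
  ratf_eval (FracField.tofrac p / FracField.tofrac q) x = p.[x] / q.[x].
Proof.
move=> qx; set f := (X in ratf_eval X).
have nzq : q != 0 by apply: contraNneq qx => ->; rewrite horner0.
have E : ratf_num f * q = p * ratf_den f.
  apply/eqP; rewrite -tofrac_eq !tofracM; apply/eqP.
  have := ratf_numden f; rewrite {1}/f => /eqP.
  by rewrite eqr_div ?tofrac_eq0 ?ratf_den_neq0 // => /eqP ->.
have Ex : (ratf_num f).[x] * q.[x] = p.[x] * (ratf_den f).[x].
  by rewrite -!hornerM E.
have dx : (ratf_den f).[x] != 0.
  apply/negP => dx0; move: Ex; rewrite (eqP dx0) mulr0 => /eqP.
  rewrite mulf_eq0 (negbTE qx) orbF => nx0.
  by have := coprimep_root (ratf_coprime f) nx0; rewrite dx0.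
by apply/eqP; rewrite /ratf_eval eqr_div // Ex.
Qed.

(* Main.v *)
(** Put [t = a_n / a_(n-1)], [u' = u(n+1)] and [v' = v(n+1)].  Solving the
    recurrence for the neighbouring ratios gives
    [a_(n-1) / a_(n-2) = v / (t - u)] and [a_(n+1) / a_n = u' + v' / t], so the
    log-concavity inequality at [t] says exactly that the quartic
    [t^4 - u t^3 - u' v t - v v'] is nonnegative.  On [t >= u] this quartic is
    nondecreasing because [u^3 > u' v], and it is positive at [g(n)], which lies
    between [u(n)] and [t]. *)

Require Import Defs.
From mathcomp Require Import all_boot all_order all_algebra.
From mathcomp Require Import reals ring.
Import Order.TTheory GRing.Theory Num.Theory.
Local Open Scope ring_scope.

(** The difference of the two sides is [(t^3 - g^3)(t - u) + (g^3 - w)(t - g)], where every factor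
    is nonnegative. *)
Lemma ratio_quartic_le (R : realFieldType) (u w c g t : R) :
    0 <= u -> w <= u ^+ 3 -> u <= g -> g <= t ->
  g ^+ 4 - u * g ^+ 3 - w * g - c <= t ^+ 4 - u * t ^+ 3 - w * t - c.
Proof.
move=> u0 wu ug gt.
have g0 : 0 <= g by apply: le_trans ug.
have wg : w <= g ^+ 3 by apply: (le_trans wu); rewrite lerXn2r ?nnegrE.
have gt3 : g ^+ 3 <= t ^+ 3 by rewrite lerXn2r ?nnegrE // (le_trans g0).
have ut : u <= t by apply: le_trans gt.
rewrite -subr_ge0; have -> : t ^+ 4 - u * t ^+ 3 - w * t - c -
    (g ^+ 4 - u * g ^+ 3 - w * g - c) =
    (t ^+ 3 - g ^+ 3) * (t - u) + (g ^+ 3 - w) * (t - g) by ring.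
by apply: addr_ge0; apply: mulr_ge0; rewrite ?subr_ge0.
Qed.

(** For four consecutive terms [x, y, z, s], the gap in the conclusion is the quartic at [z / y]
    times the positive factor [y^2 / (v x z)]. *)
Lemma consecutive_ratios_log_concave (R : realFieldType)
    (u v u' v' x y z s : R) :
    0 < v -> 0 < x -> 0 < y -> 0 < z ->
    z = u * y + v * x -> s = u' * z + v' * y ->
    0 <= (z / y) ^+ 4 - u * (z / y) ^+ 3 - u' * v * (z / y) - v * v' ->
  y / x * (s / z) <= (z / y) ^+ 2.
Proof.
move=> v0 x0 y0 z0 zE sE q0.
have [xn yn zn vn] : [/\ x != 0, y != 0, z != 0 & v != 0].
  by split; apply: lt0r_neq0.
(* Running the recurrence backwards eliminates [x]; [z - u * y] then becomes a denominator. *)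
have xE : x = (z - u * y) / v by rewrite zE; field.
have zuy : z - u * y != 0 by apply: contra_neq xn => e; rewrite xE e mul0r.
rewrite -subr_ge0; set q := (X in 0 <= X) in q0.
have -> : (z / y) ^+ 2 - y / x * (s / z) = q * y ^+ 2 / (v * x * z).
  by rewrite /q sE xE; field; rewrite yn zn vn zuy.
by rewrite divr_ge0 ?mulr_ge0 ?exprn_ge0 // ltW.
Qed.

Theorem theorem4p1 (R : realType) (u v : {fraction {poly R}}) (a : nat -> R)
    (hu : forall n : nat, (2 <= n)%N -> 0 < ratf_eval u n%:R)
    (ha : forall n : nat, 0 < a n)
    (hrec : forall n : nat, (2 <= n)%N ->
      a n = ratf_eval u n%:R * a (n - 1)%N + ratf_eval v n%:R * a (n - 2)%N)
    (hv : forall n : nat, (2 <= n)%N -> 0 < ratf_eval v n%:R)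
    (huv : forall n : nat, (2 <= n)%N ->
      ratf_eval u n%:R ^+ 3 > ratf_eval u n.+1%:R * ratf_eval v n%:R)
    (N : nat) (g : nat -> R)
    (hi : forall n : nat, (N + 2 <= n)%N ->
      a n / a (n - 1)%N >= g n /\ g n >= ratf_eval u n%:R)
    (hii : forall n : nat, (N + 2 <= n)%N ->
      g n ^+ 4 - ratf_eval u n%:R * g n ^+ 3
        - ratf_eval u n.+1%:R * ratf_eval v n%:R * g n
        - ratf_eval v n%:R * ratf_eval v n.+1%:R > 0) :
  ratio_log_concave_from N a.
Proof.
split=> [n _|]; first exact: ha.
split=> [n _|[//|n] Nn]; first by rewrite divr_gt0.
(* The middle ratio is [a n.+2 / a n.+1], so the hypotheses are used at index [n.+2]. *)
have n2 : (2 <= n.+2)%N by [].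
have Nn2 : (N + 2 <= n.+2)%N by rewrite addn2 ltnS.
have [gt ug] := hi n.+2 Nn2.
have recz := hrec n.+2 n2; have recs := hrec n.+3 isT.
rewrite !subSS !subn0 in gt recz recs.
apply: consecutive_ratios_log_concave (hv _ n2) _ _ _ recz recs _ => //.
apply: (le_trans (ltW (hii _ Nn2))).
by apply: ratio_quartic_le => //; apply: ltW; [apply: hu|apply: huv].
Qed.
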